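(* Let $i$ and $j$ be distinct integers in $\{1,\dots,7\}$, let $U$ and $V$ be finite-dimensional vector spaces over $\mathbb{F}_2$, and let $\mathcal{S}$ be a linear subspace of $\mathcal{L}(U,V)$. Then $\mathcal{S}$ cannot have both Type $i$ and Type $j$.
   Context: $\mathcal{L}(U,V)$ is the space of linear operators from $U$ to $V$; $\mathrm{M}_{n,p}(\mathbb{F}_2)$ is the space of $n\times p$ matrices over $\mathbb{F}_2$ ($n$ or $p$ may be $0$); $\mathrm{S}_n(\mathbb{F}_2)$ is the space of symmetric $n\times n$ matrices. For $\mathcal{A}\subset \mathrm{M}_{m,p}(\mathbb{F}_2)$ and $\mathcal{B}\subset \mathrm{M}_{n,q}(\mathbb{F}_2)$, set $$\mathcal{A}\vee\mathcal{B}:=\left\{\begin{bmatrix}A & C\\ 0_{n\times p} & B\end{bmatrix} : A\in\mathcal{A},\ B\in\mathcal{B},\ C\in \mathrm{M}_{m,q}(\mathbb{F}_2)\right\}\subset \mathrm{M}_{m+n,p+q}(\mathbb{F}_2).$$ For $\mathcal{A}\subset \mathrm{M}_{n,p}(\mathbb{F}_2)$ and $\mathcal{B}\subset \mathrm{M}_{n,q}(\mathbb{F}_2)$, set $\mathcal{A}\coprod\mathcal{B}:=\{[A\ \ B] : A\in\mathcal{A},\ B\in\mathcal{B}\}\subset \mathrm{M}_{n,p+q}(\mathbb{F}_2)$. Special matrix spaces (all parameters range over $\mathbb{F}_2$): $$\mathcal{V}_2:=\left\{\begin{bmatrix} a&b\\ b&c\\ c&0\end{bmatrix}\right\},\quad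 \mathcal{G}_3:=\left\{\begin{bmatrix} a&c&b\\ 0&b+c&e\\ b&d&f\end{bmatrix}\right\},\quad \mathcal{H}_3:=\left\{\begin{bmatrix} a&b&c\\ b&d&f\\ c&e&b+c+d\end{bmatrix}\right\},$$ $$\mathcal{I}_3:=\left\{\begin{bmatrix} a&d&e\\ b&c&f\\ c&a&a+c+e+f\end{bmatrix}\right\},\quad \mathcal{H}_4:=\left\{\begin{bmatrix} a&b+c&f&h\\ b&d&a+c&i\\ c&e&g&a+b\end{bmatrix}\right\}.$$ A linear subspace $\mathcal{S}$ of $\mathcal{L}(U,V)$ has Type $i$ when, in some bases of $U$ and $V$, it is represented by the following matrix space: Type 1: $\mathrm{S}_2(\mathbb{F}_2)\vee \mathrm{M}_{n,p}(\mathbb{F}_2)$ for some $n\ge0$, $p\ge 0$; Type 2: $\mathrm{S}_3(\mathbb{F}_2)\coprod \mathrm{M}_{3,p}(\mathbb{F}_2)$ for some $p\ge0$; Type 3: $\mathcal{V}_2\vee \mathrm{M}_{n,p}(\mathbb{F}_2)$ for some $n\ge0$, $p\ge 0$; Type 4: $\mathcal{G}_3\coprod \mathrm{M}_{3,p}(\mathbb{F}_2)$ for some $p\ge0$; Type 5: $\mathcal{H}_3\coprod \mathrm{M}_{3,p}(\mathbb{F}_2)$ for some $p\ge0$; Type 6: $\mathcal{I}_3\coprod \mathrm{M}_{3,p}(\mathbb{F}_2)$ for some $p\ge0$; Type 7: $\mathcal{H}_4\coprod \mathrm{M}_{3,p}(\mathbb{F}_2)$ for some $p\ge0$. *)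

(* Defs.v *)
From HB Require Import structures.
From mathcomp Require Import all_boot all_order all_algebra.

Set Implicit Arguments.
Unset Strict Implicit.
Unset Printing Implicit Defensive.

Import GRing.Theory.
Local Open Scope ring_scope.

Definition mx_of_rows (m n : nat) (s : seq (seq 'F_2)) : 'M['F_2]_(m, n) :=
  \matrix_(i < m, j < n) (nth [::] s i)`_j.

Definition mxjoin (m p n q : nat)
    (A : {set 'M['F_2]_(m, p)}) (B : {set 'M['F_2]_(n, q)}) :
    {set 'M['F_2]_(m + n, p + q)} :=
  [set block_mx X.1 C 0 X.2 |
    X : 'M['F_2]_(m, p) * 'M['F_2]_(n, q) in setX A B,
    C : 'M['F_2]_(m, q) in [set: 'M['F_2]_(m, q)]].

Definition mxcoprod (n p q : nat)
    (A : {set 'M['F_2]_(n, p)}) (B : {set 'M['F_2]_(n, q)}) :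
    {set 'M['F_2]_(n, p + q)} :=
  [set row_mx X Y | X in A, Y in B].

Definition mxfull (n p : nat) : {set 'M['F_2]_(n, p)} := setT.

Definition mxsym (n : nat) : {set 'M['F_2]_(n, n)} := [set M | M^T == M].

Definition V2 : {set 'M['F_2]_(3, 2)} :=
  [set M | [exists a : 'F_2, exists b : 'F_2, exists c : 'F_2,
    M == mx_of_rows 3 2 [:: [:: a; b];
                            [:: b; c];
                            [:: c; 0]]]].

Definition G3 : {set 'M['F_2]_(3, 3)} :=
  [set M | [exists a : 'F_2, exists b : 'F_2, exists c : 'F_2,
            exists d : 'F_2, exists e : 'F_2, exists f : 'F_2,
    M == mx_of_rows 3 3 [:: [:: a; c; b];
                            [:: 0; b + c; e];
                            [:: b; d; f]]]].

Definition H3 : {set 'M['F_2]_(3, 3)} :=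
  [set M | [exists a : 'F_2, exists b : 'F_2, exists c : 'F_2,
            exists d : 'F_2, exists e : 'F_2, exists f : 'F_2,
    M == mx_of_rows 3 3 [:: [:: a; b; c];
                            [:: b; d; f];
                            [:: c; e; b + c + d]]]].

Definition I3 : {set 'M['F_2]_(3, 3)} :=
  [set M | [exists a : 'F_2, exists b : 'F_2, exists c : 'F_2,
            exists d : 'F_2, exists e : 'F_2, exists f : 'F_2,
    M == mx_of_rows 3 3 [:: [:: a; d; e];
                            [:: b; c; f];
                            [:: c; a; a + c + e + f]]]].

Definition H4 : {set 'M['F_2]_(3, 4)} :=
  [set M | [exists a : 'F_2, exists b : 'F_2, exists c : 'F_2,
            exists d : 'F_2, exists e : 'F_2, exists f : 'F_2,
            exists g : 'F_2, exists h : 'F_2, exists i : 'F_2,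
    M == mx_of_rows 3 4 [:: [:: a; b + c; f; h];
                            [:: b; d; a + c; i];
                            [:: c; e; g; a + b]]]].

(* Column j holds the coordinates of the image of the j-th basis vector, so the
   matrix acts on columns; [passmx.mxof] acts on rows and is indexed by
   [\dim {:U}] and [\dim {:V}]. *)
Definition mx_in_bases (U V : vectType 'F_2) (m n : nat)
    (e : n.-tuple U) (f : m.-tuple V) (u : 'Hom(U, V)) : 'M['F_2]_(m, n) :=
  \matrix_(i < m, j < n) coord f i (u e`_j).

Definition represented_by (U V : vectType 'F_2) (S : {vspace 'Hom(U, V)})
    (m n : nat) (A : {set 'M['F_2]_(m, n)}) : Prop :=
  exists (e : n.-tuple U) (f : m.-tuple V),
    [/\ basis_of {:U} e, basis_of {:V} f
      & forall M : 'M['F_2]_(m, n),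
          M \in A <-> exists2 u, u \in S & M = mx_in_bases e f u].

Definition has_type (U V : vectType 'F_2) (i : nat) (S : {vspace 'Hom(U, V)}) :
    Prop :=
  match i with
  | 1 => exists n p : nat, represented_by S (mxjoin (mxsym 2) (mxfull n p))
  | 2 => exists p : nat, represented_by S (mxcoprod (mxsym 3) (mxfull 3 p))
  | 3 => exists n p : nat, represented_by S (mxjoin V2 (mxfull n p))
  | 4 => exists p : nat, represented_by S (mxcoprod G3 (mxfull 3 p))
  | 5 => exists p : nat, represented_by S (mxcoprod H3 (mxfull 3 p))
  | 6 => exists p : nat, represented_by S (mxcoprod I3 (mxfull 3 p))
  | 7 => exists p : nat, represented_by S (mxcoprod H4 (mxfull 3 p))
  | _ => False
  end.

(* Main.v *)
Require Import Defs.
From mathcomp Require Import all_boot all_order all_algebra.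

(** In any two representations of the same operator space by matrix spaces [A]
and [B], base change gives invertible [P] and [Q] with [B = P A Q]. The types
are therefore told apart by properties of a matrix space [A] of [m] by [n]
matrices that are invariant under [A -> P A Q]. Four of them suffice:
- [absorbing k]: some [k] vectors of the source are such that every matrix
  killing them all lies in [A];
- [symmetrizable]: for some nonzero [R], all the products [M R], with [M] in
  [A], are symmetric;
- [degenerate]: for some nonzero row [u] and column [x], [u M x = 0] on [A];
- [injectively_annihilated]: for some injective [R], [tr (M R) = 0] on [A]; in
  other words the orthogonal of [A] for the trace pairing contains a matrix of
  rank [m].

The property [absorbing 2] holds for Types 1 and 3 only: the two vectors are
the ones carrying the block [S_2] or [V_2], whereas in the other types the three
or four columns of the block left of [M_{3,p}] are linked by equations that no
nonzero row can satisfy in every position at once. In the same way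
[absorbing 3] sets Type 7, with its four-column block, apart from Types 2, 4, 5
and 6. Types 1 and 2 are symmetrizable since their blocks consist of symmetric
matrices, and for Types 3 to 6 the symmetry conditions leave [R = 0] only; this
separates Type 1 from 3, and Type 2 from 4, 5 and 6. Of these last three, only
[G_3] is degenerate, because of its entry [0]; and the orthogonal of [H_3]
consists of singular matrices while that of [I_3] does not.

All this can be read off the small blocks: testing a property on the matrices
supported in the columns with arbitrary entries forces the corresponding
components of [R] or [x] to vanish. On a small block, each claim becomes a
system of linear or bilinear equations over the field with two elements,
obtained by giving one parameter at a time the value [1]. *)

Set Implicit Arguments.
Unset Strict Implicit.
Unset Printing Implicit Defensive.

Import GRing.Theory.
Local Open Scope ring_scope.

(** * Equivalence of matrix spaces and invariant properties *)

Definition equivalent_by m n (P : 'M['F_2]_m) (Q : 'M['F_2]_n)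
    (A B : {set 'M['F_2]_(m, n)}) : Prop :=
  [/\ P \in unitmx, Q \in unitmx & forall M, (M \in A) = (P *m M *m Q \in B)].

Definition set_property := forall m n, {set 'M['F_2]_(m, n)} -> Prop.

Definition equivalence_invariant (I : set_property) : Prop :=
  forall m n P Q (A B : {set 'M['F_2]_(m, n)}),
    equivalent_by P Q A B -> I m n A -> I m n B.

Lemma mx_in_basesB (U V : vectType 'F_2) m n (e : n.-tuple U) (f : m.-tuple V)
    (e' : n.-tuple U) (f' : m.-tuple V) :
    basis_of {:U} e -> basis_of {:V} f ->
  forall u : 'Hom(U, V), mx_in_bases e' f' u =
    (\matrix_(i, k) coord f' i f`_k) *m mx_in_bases e f u *m
    (\matrix_(l, j) coord e l e'`_j).
Proof.
move=> be bf u; apply/matrixP => i j; rewrite !mxE.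
rewrite [in LHS](coord_basis be (memvf e'`_j)) !linear_sum /=.
apply: eq_bigr => l _; rewrite !linearZ /= !mxE mulrC; congr (_ * _).
rewrite {1}(coord_basis bf (memvf (u e`_l))) linear_sum /=.
by apply: eq_bigr => k _; rewrite linearZ /= !mxE mulrC.
Qed.

Lemma base_change_unit (U : vectType 'F_2) n (e e' : n.-tuple U) :
    basis_of {:U} e -> basis_of {:U} e' ->
  \matrix_(l, j) coord e l e'`_j \in unitmx.
Proof.
move=> be be'.
suff /mulmx1_unit[-> _] : (\matrix_(l, j) coord e l e'`_j) *m
  (\matrix_(l, j) coord e' l e`_j) = 1%:M by [].
apply/matrixP => l j; rewrite !mxE eq_sym.
rewrite -(coord_free j l (basis_free be)).
rewrite [in RHS](coord_basis be' (memvf e`_j)) linear_sum /=.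
by apply: eq_bigr => k _; rewrite linearZ !mxE /= mulrC.
Qed.

Lemma represented_by_equivalent (U V : vectType 'F_2) (S : {vspace 'Hom(U, V)})
    m n (A B : {set 'M['F_2]_(m, n)}) :
    represented_by S A -> represented_by S B ->
  exists P Q, equivalent_by P Q A B.
Proof.
move=> [e [f [be bf SA]]] [e' [f' [be' bf' SB]]].
exists (\matrix_(i, k) coord f' i f`_k), (\matrix_(l, j) coord e l e'`_j).
have Pu := base_change_unit bf' bf; have Qu := base_change_unit be be'.
split=> // M; apply/idP/idP => [/SA[u uS ->] | /SB[u uS]].
  by apply/SB; exists u => //; rewrite -mx_in_basesB.
rewrite (mx_in_basesB e' f' be bf) => /(can_inj (mulmxK Qu)).
by move/(can_inj (mulKmx Pu)) => ->; apply/SA; exists u.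
Qed.

(** The sizes of the two matrix spaces agree only propositionally, as dimensions
of [V] and [U]; this is why a property is a family over all sizes. *)
Lemma represented_by_invariant (I : set_property) (U V : vectType 'F_2)
    (S : {vspace 'Hom(U, V)}) m n (A : {set 'M['F_2]_(m, n)})
    m' n' (B : {set 'M['F_2]_(m', n')}) :
    equivalence_invariant I -> represented_by S A -> represented_by S B ->
  I m n A -> I m' n' B.
Proof.
move=> invI SA SB.
have [[e [f [be bf _]]] [e' [f' [be' bf' _]]]] := (SA, SB).
have em : m = m' by rewrite -(size_basis bf) (size_basis bf').
have en : n = n' by rewrite -(size_basis be) (size_basis be').
move: em en B SB {e' f' be' bf'} => <- <- B SB.
by have [P [Q eqAB]] := represented_by_equivalent SA SB; apply: invI eqAB.
Qed.

(** * The four distinguishing properties *)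

Definition absorbing k : set_property := fun m n A =>
  exists W : 'M['F_2]_(n, k), forall M : 'M_(m, n), M *m W = 0 -> M \in A.

Definition symmetrizable : set_property := fun m n A =>
  exists2 R : 'M['F_2]_(n, m), R != 0 &
    forall M, M \in A -> (M *m R)^T = M *m R.

Definition degenerate : set_property := fun m n A =>
  exists2 u : 'rV['F_2]_m, u != 0 & exists2 x : 'cV['F_2]_n, x != 0 &
    forall M, M \in A -> u *m M *m x = 0.

Definition injectively_annihilated : set_property := fun m n A =>
  exists2 R : 'M['F_2]_(n, m), row_full R &
    forall M, M \in A -> \tr (M *m R) = 0.

Lemma equivalent_byE m n P Q (A B : {set 'M['F_2]_(m, n)}) :
    equivalent_by P Q A B ->
  forall M, (M \in B) = (invmx P *m M *m invmx Q \in A).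
Proof.
case=> Pu Qu eqAB M; rewrite eqAB.
by rewrite !mulmxA mulmxV // mul1mx mulmxKV.
Qed.

Lemma absorbing_invariant k : equivalence_invariant (absorbing k).
Proof.
move=> m n P Q A B eqAB [W WA]; exists (invmx Q *m W) => M MW.
by rewrite (equivalent_byE eqAB); apply: WA; rewrite -!mulmxA MW mulmx0.
Qed.

Lemma symmetrizable_invariant : equivalence_invariant symmetrizable.
Proof.
move=> m n P Q A B eqAB [R R0 symR]; have [Pu Qu _] := eqAB.
exists (invmx Q *m R *m P^T) => [|M].
  apply: contraNneq R0 => /(congr1 (fun X => Q *m X *m invmx P^T)) /eqP.
  by rewrite mulmx0 mul0mx -!mulmxA mulmxV ?unitmx_tr // mulmx1 mulKVmx.
rewrite (equivalent_byE eqAB) => /symR symM.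
have -> : M *m (invmx Q *m R *m P^T)
          = P *m (invmx P *m M *m invmx Q *m R) *m P^T.
  by rewrite !mulmxA (mulmxV Pu) mul1mx.
by rewrite trmx_mul trmxK (trmx_mul P) symM mulmxA.
Qed.

Lemma degenerate_invariant : equivalence_invariant degenerate.
Proof.
move=> m n P Q A B eqAB [u u0 [x x0 uAx]]; have [Pu Qu _] := eqAB.
exists (u *m invmx P).
  by apply: contraNneq u0 => uP; rewrite -(mulmxKV Pu u) uP mul0mx.
exists (invmx Q *m x) => [|M].
  by apply: contraNneq x0 => Qx; rewrite -(mulKVmx Qu x) Qx mulmx0.
by rewrite (equivalent_byE eqAB) => /uAx; rewrite !mulmxA.
Qed.

Lemma injectively_annihilated_invariant :
  equivalence_invariant injectively_annihilated.
Proof.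
move=> m n P Q A B eqAB [R Rf trR]; have [Pu Qu _] := eqAB.
exists (invmx Q *m R *m invmx P) => [|M].
  by rewrite /row_full mxrankMfree ?row_free_unit ?unitmx_inv // eqmxMfull
     ?row_full_unit ?unitmx_inv.
by rewrite (equivalent_byE eqAB) => /trR; rewrite -!mulmxA mxtrace_mulC !mulmxA.
Qed.

(** * Reduction to the small blocks *)

Lemma mul_row0r m p q r (M : 'M['F_2]_(m, p)) (R : 'M_(p + q, r)) :
  row_mx M 0 *m R = M *m usubmx R.
Proof. by rewrite -[R in LHS]vsubmxK mul_row_col mul0mx addr0. Qed.

Lemma mul_row0l m p q r (M : 'M['F_2]_(m, q)) (R : 'M_(p + q, r)) :
  row_mx 0 M *m R = M *m dsubmx R.
Proof. by rewrite -[R in LHS]vsubmxK mul_row_col mul0mx add0r. Qed.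

Lemma mem_mxcoprod m p q (A : {set 'M['F_2]_(m, p)}) (X : 'M_(m, p))
    (Y : 'M_(m, q)) :
  (row_mx X Y \in mxcoprod A (mxfull m q)) = (X \in A).
Proof.
apply/imset2P/idP => [[X' Y' AX' _ /eq_row_mx[-> _]] // | AX].
by exists X Y; rewrite ?in_setT.
Qed.

Lemma mem_mxjoin m p n q (A : {set 'M['F_2]_(m, p)}) (X : 'M_(m, p))
    (C : 'M_(m, q)) (Z : 'M_(n, p)) (Y : 'M_(n, q)) :
  (block_mx X C Z Y \in mxjoin A (mxfull n q)) = (X \in A) && (Z == 0).
Proof.
apply/imset2P/andP => [[[X' Y'] C' /setXP[/= AX' _] _] | [AX /eqP->]].
  by case/eq_block_mx => -> _ -> _.
by exists (X, Y) C; rewrite ?in_setX ?AX ?in_setT.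
Qed.

Lemma absorbing_mxcoprod m p q (A : {set 'M['F_2]_(m, p)}) :
  0 \in A -> absorbing p (mxcoprod A (mxfull m q)).
Proof.
move=> A0; exists (col_mx 1%:M 0) => M; rewrite -[M]hsubmxK mul_row_col.
by rewrite mulmx1 mulmx0 addr0 mem_mxcoprod => ->.
Qed.

Lemma absorbing_mxjoin m p n q (A : {set 'M['F_2]_(m, p)}) :
  0 \in A -> absorbing p (mxjoin A (mxfull n q)).
Proof.
move=> A0; exists (col_mx 1%:M 0) => M; rewrite -[M]submxK mul_block_col.
rewrite !mulmx1 !mulmx0 !addr0 -[0 in RHS]vsubmxK => /eq_col_mx[-> ->].
by rewrite mem_mxjoin !linear0 A0 eqxx.
Qed.

Definition row_at m n i (w : 'rV['F_2]_n) : 'M['F_2]_(m, n) :=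
  \matrix_(k, j) if k == i then w 0 j else 0.

Lemma row_atE m n i (w : 'rV['F_2]_n) : row_at i w = delta_mx (i : 'I_m) 0 *m w.
Proof.
apply/matrixP => k j; rewrite !mxE big_ord1 mxE eqxx andbT.
by case: eqP; rewrite ?mul1r ?mul0r.
Qed.

(** With fewer than [p] vectors, some nonzero linear form [w] in the first [p]
coordinates vanishes on all of them, so that every matrix having [w] as its only
nonzero row is absorbed. *)
Lemma nonabsorbing_mxcoprod k m p q (A : {set 'M['F_2]_(m, p)}) :
    (k < p)%N ->
    (forall w : 'rV_p, (forall i, row_at i w \in A) -> w = 0) ->
  ~ absorbing k (mxcoprod A (mxfull m q)).
Proof.
move=> ltkp rowA [W WA].
have: kermx (usubmx W) != 0.
  rewrite kermx_eq0 /row_free neq_ltn; apply/orP; left.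
  exact: leq_ltn_trans (rank_leq_col _) ltkp.
case/rowV0Pn => w /sub_kermxP wW /eqP[]; apply: rowA => i.
rewrite row_atE -(mem_mxcoprod _ _ (0 : 'M_(m, q))); apply: WA.
by rewrite -[W]vsubmxK mul_row_col mul0mx addr0 -mulmxA wW mulmx0.
Qed.

(** The matrix unit [(i, j)] times [R] has row [j] of [R] in row [i]; its
symmetry kills the entries off column [i], and [i] is free as there are two rows
at least. *)
Lemma mulmx_sym_eq0 m p (R : 'M['F_2]_(p, m)) :
    (1 < m)%N ->
  (forall M : 'M_(m, p), (M *m R)^T = M *m R) -> R = 0.
Proof.
move=> m1 symR; apply/matrixP => j k.
have [i neq_ik] : exists i : 'I_m, i != k.
  exists (if k == Ordinal m1 then Ordinal (ltnW m1) else Ordinal m1).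
  by case: ifP => [/eqP-> | /negbT]; rewrite // eq_sym.
have /matrixP/(_ k i) := symR (delta_mx i j).
rewrite !mxE (bigD1 j) //= big1 => [|l /negbTE lj]; last first.
  by rewrite !mxE lj andbF mul0r.
rewrite !mxE !eqxx mul1r addr0 => ->.
by rewrite big1 // => l _; rewrite !mxE eq_sym (negbTE neq_ik) mul0r.
Qed.

Lemma unsymmetrizable_mxcoprod m p q (A : {set 'M['F_2]_(m, p)}) :
    (1 < m)%N -> 0 \in A ->
    (forall R : 'M_(p, m), (forall M, M \in A -> (M *m R)^T = M *m R) ->
      R = 0) ->
  ~ symmetrizable (mxcoprod A (mxfull m q)).
Proof.
move=> m1 A0 symA0 [R /eqP R0 symR]; apply: R0.
have Rd0 : dsubmx R = 0.
  apply: mulmx_sym_eq0 => // M; have := symR (row_mx 0 M).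
  by rewrite mem_mxcoprod mul_row0l => /(_ A0).
rewrite -[R]vsubmxK Rd0 (symA0 (usubmx R)) ?col_mx0 // => M AM.
have := symR (row_mx M 0); rewrite mem_mxcoprod mul_row0r.
exact.
Qed.

Lemma symmetrizable_mxsym_coprod m q :
  symmetrizable (mxcoprod (mxsym m.+1) (mxfull m.+1 q)).
Proof.
exists (col_mx 1%:M 0) => [|M].
  apply/eqP => /(congr1 usubmx); rewrite col_mxKu linear0 => /eqP.
  by rewrite oner_eq0.
rewrite -[M]hsubmxK mem_mxcoprod inE mul_row_col mulmx0 addr0 mulmx1.
by move/eqP.
Qed.

Lemma symmetrizable_mxsym_join m n q :
  symmetrizable (mxjoin (mxsym m.+1) (mxfull n q)).
Proof.
exists (block_mx 1%:M 0 0 0) => [|M].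
  apply/eqP => /(congr1 ulsubmx); rewrite block_mxKul /ulsubmx !linear0 => /eqP.
  by rewrite oner_eq0.
rewrite -[M]submxK mem_mxjoin inE mulmx_block !mulmx0 !mulmx1 !addr0.
by case/andP => /eqP symM /eqP->; rewrite tr_block_mx symM !trmx0.
Qed.

Lemma nondegenerate_mxcoprod m p q (A : {set 'M['F_2]_(m, p)}) :
    0 \in A ->
    (forall (u : 'rV_m) (x : 'cV_p), (forall M, M \in A -> u *m M *m x = 0) ->
      u = 0 \/ x = 0) ->
  ~ degenerate (mxcoprod A (mxfull m q)).
Proof.
move=> A0 ndegA [u u0 [x /eqP x0 uAx]]; apply: x0.
have [i ui] : exists i, u 0 i != 0 by apply/rV0Pn.
have xd0 : dsubmx x = 0.
  apply/colP => j; have := uAx (row_mx 0 (delta_mx i j)).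
  rewrite mem_mxcoprod -mulmxA mul_row0l => /(_ A0)/matrixP/(_ 0 0).
  rewrite mxE (bigD1 i) //= big1 => [|k /negbTE ki]; last first.
    by rewrite mxE big1 ?mulr0 // => l _; rewrite !mxE ki mul0r.
  rewrite addr0 mxE (bigD1 j) //= big1 => [|k /negbTE kj]; last first.
    by rewrite !mxE kj andbF mul0r.
  rewrite !mxE !eqxx mul1r addr0 => /eqP; rewrite mulf_eq0 (negbTE ui).
  exact/eqP.
have [|ueq0|xu0] := ndegA u (usubmx x).
- move=> M AM; have := uAx (row_mx M 0).
  by rewrite mem_mxcoprod -mulmxA mul_row0r mulmxA; apply.
- by rewrite ueq0 eqxx in u0.
- by rewrite -[x]vsubmxK xd0 xu0 col_mx0.
Qed.

Lemma degenerate_mxcoprod m p q (A : {set 'M['F_2]_(m, p)}) :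
  degenerate A -> degenerate (mxcoprod A (mxfull m q)).
Proof.
move=> [u u0 [x x0 uAx]]; exists u => //; exists (col_mx x 0) => [|M].
  by rewrite col_mx_eq0 negb_and x0.
rewrite -[M]hsubmxK mem_mxcoprod -mulmxA mul_row_col mulmx0 addr0 mulmxA.
exact: uAx.
Qed.

Lemma not_injectively_annihilated_mxcoprod m p q (A : {set 'M['F_2]_(m, p)}) :
    0 \in A ->
    (forall R : 'M_(p, m), (forall M, M \in A -> \tr (M *m R) = 0) ->
      ~~ row_full R) ->
  ~ injectively_annihilated (mxcoprod A (mxfull m q)).
Proof.
move=> A0 annA [R Rf trR].
have Rd0 : dsubmx R = 0.
  apply/matrixP => j i; have := trR (row_mx 0 (delta_mx i j)).
  rewrite mem_mxcoprod mul_row0l mxtrace_mulC => /(_ A0).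
  rewrite /mxtrace (bigD1 j) //= big1 => [|k kj].
    rewrite addr0 mxE (bigD1 i) //= big1 => [|k /negbTE ki]; last first.
      by rewrite !mxE ki mulr0.
    by rewrite !mxE !eqxx mulr1 addr0.
  by rewrite mxE big1 // => l _; rewrite !mxE (negbTE kj) andbF mulr0.
have /negP[] : ~~ row_full (usubmx R).
  apply: annA => M AM; have := trR (row_mx M 0).
  by rewrite mem_mxcoprod mul_row0r; apply.
by move: Rf; rewrite -{1}[R]vsubmxK Rd0 /row_full -addsmxE addsmx0.
Qed.

Lemma injectively_annihilated_mxcoprod m p q (A : {set 'M['F_2]_(m, p)}) :
  injectively_annihilated A ->
  injectively_annihilated (mxcoprod A (mxfull m q)).
Proof.
move=> [R Rf trR]; exists (col_mx R 0) => [|M].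
  by rewrite /row_full -addsmxE addsmx0.
rewrite -[M]hsubmxK mem_mxcoprod mul_row_col mulmx0 addr0; exact: trR.
Qed.

(** * Equations and parametrizations of the small blocks *)

Local Notation i0 := (@Ordinal 3 0 isT).
Local Notation i1 := (@Ordinal 3 1 isT).
Local Notation i2 := (@Ordinal 3 2 isT).
Local Notation j0 := (@Ordinal 2 0 isT).
Local Notation j1 := (@Ordinal 2 1 isT).
Local Notation k0 := (@Ordinal 4 0 isT).
Local Notation k1 := (@Ordinal 4 1 isT).
Local Notation k2 := (@Ordinal 4 2 isT).
Local Notation k3 := (@Ordinal 4 3 isT).

Lemma forall_I2 (P : 'I_2 -> Prop) : P j0 -> P j1 -> forall i, P i.
Proof.
by move=> P0 P1 [[|[|//]] i]; rewrite (bool_irrelevance i isT).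
Qed.

Lemma forall_I3 (P : 'I_3 -> Prop) : P i0 -> P i1 -> P i2 -> forall i, P i.
Proof.
by move=> P0 P1 P2 [[|[|[|//]]] i]; rewrite (bool_irrelevance i isT).
Qed.

Lemma forall_I4 (P : 'I_4 -> Prop) :
  P k0 -> P k1 -> P k2 -> P k3 -> forall i, P i.
Proof.
by move=> P0 P1 P2 P3 [[|[|[|[|//]]]] i]; rewrite (bool_irrelevance i isT).
Qed.

Lemma sum_I2 (F : 'I_2 -> 'F_2) : \sum_i F i = F j0 + F j1.
Proof.
rewrite !big_ord_recl big_ord0 addr0.
by congr (F _ + F _); apply: val_inj.
Qed.

Lemma sum_I3 (F : 'I_3 -> 'F_2) : \sum_i F i = F i0 + (F i1 + F i2).
Proof.
rewrite !big_ord_recl big_ord0 addr0.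
by congr (F _ + (F _ + F _)); apply: val_inj.
Qed.

Lemma F2P (x : 'F_2) : x = 0 \/ x = 1.
Proof. by case: x => [[|[|//]] ltx]; [left | right]; apply: val_inj. Qed.

Lemma V2P (M : 'M_(3, 2)) : reflect
  [/\ M i1 j0 = M i0 j1, M i2 j0 = M i1 j1 & M i2 j1 = 0] (M \in V2).
Proof.
rewrite inE; apply: (iffP idP).
  do 3 (case/existsP => ?); move/eqP->.
  by rewrite !mxE.
case=> e1 e2 e3.
apply/existsP; exists (M i0 j0); apply/existsP; exists (M i0 j1).
apply/existsP; exists (M i1 j1).
apply/eqP/matrixP; apply: forall_I3; apply: forall_I2; by rewrite mxE.
Qed.

Lemma S3P (M : 'M_3) : reflect
  [/\ M i1 i0 = M i0 i1, M i2 i0 = M i0 i2 & M i2 i1 = M i1 i2] (M \in mxsym 3).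
Proof.
rewrite inE; apply: (iffP eqP) => [/matrixP symM | [e1 e2 e3]].
  by rewrite -(symM i0 i1) -(symM i0 i2) -(symM i1 i2) !mxE.
by apply/matrixP; apply: forall_I3; apply: forall_I3; rewrite mxE.
Qed.

Lemma G3P (M : 'M_3) : reflect
  [/\ M i1 i0 = 0, M i2 i0 = M i0 i2 & M i1 i1 = M i0 i2 + M i0 i1] (M \in G3).
Proof.
rewrite inE; apply: (iffP idP).
  do 6 (case/existsP => ?); move/eqP->.
  by rewrite !mxE.
case=> e1 e2 e3.
apply/existsP; exists (M i0 i0); apply/existsP; exists (M i0 i2).
apply/existsP; exists (M i0 i1); apply/existsP; exists (M i2 i1).
apply/existsP; exists (M i1 i2); apply/existsP; exists (M i2 i2).
by apply/eqP/matrixP; apply: forall_I3; apply: forall_I3; rewrite mxE.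
Qed.

Lemma H3P (M : 'M_3) : reflect
  [/\ M i1 i0 = M i0 i1, M i2 i0 = M i0 i2
    & M i2 i2 = M i0 i1 + M i0 i2 + M i1 i1] (M \in H3).
Proof.
rewrite inE; apply: (iffP idP).
  do 6 (case/existsP => ?); move/eqP->.
  by rewrite !mxE.
case=> e1 e2 e3.
apply/existsP; exists (M i0 i0); apply/existsP; exists (M i0 i1).
apply/existsP; exists (M i0 i2); apply/existsP; exists (M i1 i1).
apply/existsP; exists (M i2 i1); apply/existsP; exists (M i1 i2).
by apply/eqP/matrixP; apply: forall_I3; apply: forall_I3; rewrite mxE.
Qed.

Lemma I3P (M : 'M_3) : reflect
  [/\ M i2 i0 = M i1 i1, M i2 i1 = M i0 i0
    & M i2 i2 = M i0 i0 + M i1 i1 + M i0 i2 + M i1 i2] (M \in I3).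
Proof.
rewrite inE; apply: (iffP idP).
  do 6 (case/existsP => ?); move/eqP->.
  by rewrite !mxE.
case=> e1 e2 e3.
apply/existsP; exists (M i0 i0); apply/existsP; exists (M i1 i0).
apply/existsP; exists (M i1 i1); apply/existsP; exists (M i0 i1).
apply/existsP; exists (M i0 i2); apply/existsP; exists (M i1 i2).
by apply/eqP/matrixP; apply: forall_I3; apply: forall_I3; rewrite mxE.
Qed.

Lemma H4P (M : 'M_(3, 4)) : reflect
  [/\ M i0 k1 = M i1 k0 + M i2 k0, M i1 k2 = M i0 k0 + M i2 k0
    & M i2 k3 = M i0 k0 + M i1 k0] (M \in H4).
Proof.
rewrite inE; apply: (iffP idP).
  do 9 (case/existsP => ?); move/eqP->.
  by rewrite !mxE.
case=> e1 e2 e3.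
apply/existsP; exists (M i0 k0); apply/existsP; exists (M i1 k0).
apply/existsP; exists (M i2 k0); apply/existsP; exists (M i1 k1).
apply/existsP; exists (M i2 k1); apply/existsP; exists (M i0 k2).
apply/existsP; exists (M i2 k2); apply/existsP; exists (M i0 k3).
apply/existsP; exists (M i1 k3).
by apply/eqP/matrixP; apply: forall_I3; apply: forall_I4; rewrite mxE.
Qed.

Lemma zero_in_V2 : 0 \in V2.
Proof. by apply/V2P; rewrite !mxE. Qed.

Lemma zero_in_mxsym n : 0 \in mxsym n.
Proof. by rewrite inE trmx0. Qed.

Lemma zero_in_G3 : 0 \in G3.
Proof. by apply/G3P; rewrite !mxE addr0. Qed.

Lemma zero_in_H3 : 0 \in H3.
Proof. by apply/H3P; rewrite !mxE !addr0. Qed.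

Lemma zero_in_I3 : 0 \in I3.
Proof. by apply/I3P; rewrite !mxE !addr0. Qed.

Lemma V2_param a b c :
  mx_of_rows 3 2 [:: [:: a; b]; [:: b; c]; [:: c; 0]] \in V2.
Proof. by apply/V2P; rewrite !mxE. Qed.

Lemma G3_param a b c d e f :
  mx_of_rows 3 3 [:: [:: a; c; b]; [:: 0; b + c; e]; [:: b; d; f]] \in G3.
Proof. by apply/G3P; rewrite !mxE. Qed.

Lemma H3_param a b c d e f :
  mx_of_rows 3 3 [:: [:: a; b; c]; [:: b; d; f]; [:: c; e; b + c + d]] \in H3.
Proof. by apply/H3P; rewrite !mxE. Qed.

Lemma I3_param a b c d e f :
  mx_of_rows 3 3 [:: [:: a; d; e]; [:: b; c; f]; [:: c; a; a + c + e + f]]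
    \in I3.
Proof. by apply/I3P; rewrite !mxE. Qed.

(** * Rows that can be placed anywhere in a block *)

Lemma row_at_eq0_S3 (w : 'rV_3) : (forall i, row_at i w \in mxsym 3) -> w = 0.
Proof.
move=> rowA.
have /S3P[] := rowA i0; have /S3P[] := rowA i1.
rewrite !mxE /= => w0 _ _ w1 w2 _.
by apply/rowP; apply: forall_I3; rewrite mxE.
Qed.

Lemma row_at_eq0_G3 (w : 'rV_3) : (forall i, row_at i w \in G3) -> w = 0.
Proof.
move=> rowA.
have /G3P[] := rowA i0; have /G3P[] := rowA i1.
rewrite !mxE /= addr0 => w0 _ w1 _ w2 _.
by apply/rowP; apply: forall_I3; rewrite mxE.
Qed.

Lemma row_at_eq0_H3 (w : 'rV_3) : (forall i, row_at i w \in H3) -> w = 0.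
Proof.
move=> rowA.
have /H3P[] := rowA i0; have /H3P[] := rowA i1.
rewrite !mxE /= => w0 _ _ w1 w2 _.
by apply/rowP; apply: forall_I3; rewrite mxE.
Qed.

Lemma row_at_eq0_I3 (w : 'rV_3) : (forall i, row_at i w \in I3) -> w = 0.
Proof.
move=> rowA.
have /I3P[] := rowA i0; have /I3P[] := rowA i1.
rewrite !mxE /= !addr0 => w1 _ _ _ w0.
rewrite -w0 add0r => w2.
by apply/rowP; apply: forall_I3; rewrite mxE.
Qed.

Lemma row_at_eq0_H4 (w : 'rV_4) : (forall i, row_at i w \in H4) -> w = 0.
Proof.
move=> rowA.
have /H4P[] := rowA i0; have /H4P[] := rowA i1.
have /H4P[] := rowA i2.
rewrite !mxE /= !addr0 !add0r => w0 _ w3 _ w2 _ w1 _ _.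
by apply/rowP; apply: forall_I4; rewrite mxE.
Qed.

(** * Symmetrizability of the small blocks *)

Definition simpF2 :=
  (@mul0r 'F_2, @mul1r 'F_2, @mulr0 'F_2, @mulr1 'F_2, @addr0 'F_2,
   @add0r 'F_2).

Ltac expand H := rewrite ?sum_I2 ?sum_I3 !mxE /= ?simpF2 in H.

Lemma symmetric_entry m n (A : {set 'M['F_2]_(m, n)}) (R : 'M_(n, m)) :
    (forall M, M \in A -> (M *m R)^T = M *m R) ->
  forall M, M \in A -> forall a b,
    \sum_k M a k * R k b = \sum_k M b k * R k a.
Proof.
move=> symR M AM a b; have /matrixP/(_ b a) := symR M AM.
by rewrite !mxE.
Qed.

(** Comparing two symmetric entries of [M R], for one [M] that is most often a
matrix unit, equates two entries of [R] or kills one of them; for [H3], and for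
the blocks below, few comparisons are enough to kill all entries. *)
Lemma unsymmetrizable_H3 (R : 'M['F_2]_3) :
  (forall M, M \in H3 -> (M *m R)^T = M *m R) -> R = 0.
Proof.
move/symmetric_entry => symR.
have R01 := symR _ (H3_param 1 0 0 0 0 0) i0 i1. expand R01.
have R02 := symR _ (H3_param 1 0 0 0 0 0) i0 i2. expand R02.
have R20 := symR _ (H3_param 0 0 0 0 0 1) i1 i0. expand R20.
have R22 := symR _ (H3_param 0 0 0 0 0 1) i1 i2. expand R22.
have R10 := symR _ (H3_param 0 0 0 0 1 0) i2 i0. expand R10.
have R11 := symR _ (H3_param 0 0 0 0 1 0) i2 i1. expand R11.
have R12 := symR _ (H3_param 0 1 0 0 0 0) i0 i2. expand R12.
have R21 := symR _ (H3_param 0 0 0 1 0 0) i2 i1. expand R21.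
have R00 := symR _ (H3_param 0 1 0 0 0 0) i1 i0. expand R00.
rewrite R20 in R12; rewrite R12 in R21; rewrite R11 in R00.
by apply/matrixP; apply: forall_I3; apply: forall_I3; rewrite mxE.
Qed.

Lemma unsymmetrizable_G3 (R : 'M['F_2]_3) :
  (forall M, M \in G3 -> (M *m R)^T = M *m R) -> R = 0.
Proof.
move/symmetric_entry => symR.
have R01 := symR _ (G3_param 1 0 0 0 0 0) i0 i1. expand R01.
have R02 := symR _ (G3_param 1 0 0 0 0 0) i0 i2. expand R02.
have R10 := symR _ (G3_param 0 0 0 1 0 0) i2 i0. expand R10.
have R11 := symR _ (G3_param 0 0 0 1 0 0) i2 i1. expand R11.
have R20 := symR _ (G3_param 0 0 0 0 0 1) i2 i0. expand R20.
have R21 := symR _ (G3_param 0 0 0 0 0 1) i2 i1. expand R21.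
have R22 := symR _ (G3_param 0 0 0 0 1 0) i1 i2. expand R22.
have R12 := symR _ (G3_param 0 0 1 0 0 0) i0 i2. expand R12.
have R00 := symR _ (G3_param 0 1 0 0 0 0) i2 i0. expand R00.
rewrite R22 in R00.
by apply/matrixP; apply: forall_I3; apply: forall_I3; rewrite mxE.
Qed.

Lemma unsymmetrizable_I3 (R : 'M['F_2]_3) :
  (forall M, M \in I3 -> (M *m R)^T = M *m R) -> R = 0.
Proof.
move/symmetric_entry => symR.
have R00 := symR _ (I3_param 0 1 0 0 0 0) i1 i0. expand R00.
have R02 := symR _ (I3_param 0 1 0 0 0 0) i1 i2. expand R02.
have R11 := symR _ (I3_param 0 0 0 1 0 0) i0 i1. expand R11.
have R12 := symR _ (I3_param 0 0 0 1 0 0) i0 i2. expand R12.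
have R01 := symR _ (I3_param 1 0 0 0 0 0) i0 i1. expand R01.
have R21 := symR _ (I3_param 1 0 0 0 0 0) i2 i1. expand R21.
have R10 := symR _ (I3_param 0 0 1 0 0 0) i1 i0. expand R10.
have R20 := symR _ (I3_param 1 0 0 0 0 0) i2 i0. expand R20.
have R22 := symR _ (I3_param 0 0 0 0 1 0) i0 i2. expand R22.
rewrite R11 add0r in R21; rewrite R10 R02 add0r in R20; rewrite R20 in R22.
by apply/matrixP; apply: forall_I3; apply: forall_I3; rewrite mxE ?R22.
Qed.

Lemma unsymmetrizable_V2 (R : 'M['F_2]_(2, 3)) :
  (forall M, M \in V2 -> (M *m R)^T = M *m R) -> R = 0.
Proof.
move/symmetric_entry => symR.
have R01 := symR _ (V2_param 1 0 0) i0 i1. expand R01.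
have R02 := symR _ (V2_param 1 0 0) i0 i2. expand R02.
have R10 := symR _ (V2_param 0 0 1) i1 i0. expand R10.
have R12 := symR _ (V2_param 0 0 1) i1 i2. expand R12.
have R00 := symR _ (V2_param 0 0 1) i2 i0. expand R00.
have R11 := symR _ (V2_param 0 1 0) i0 i1. expand R11.
rewrite R01 in R12; rewrite R00 in R11.
by apply/matrixP; apply: forall_I2; apply: forall_I3; rewrite mxE.
Qed.

(** The argument for the coproducts leaves here a block [R'] with two rows and
[3 + n] columns; symmetry also makes the products of [V2] with its last [n]
columns vanish. *)
Lemma unsymmetrizable_V2_join n q : ~ symmetrizable (mxjoin V2 (mxfull n q)).
Proof.
move=> [R /eqP R0 symR]; apply: R0.
have V20 := zero_in_V2.
have Rd0 : dsubmx R = 0.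
  apply: mulmx_sym_eq0 => // M; rewrite -mul_row0l; apply: symR.
  rewrite -[M]vsubmxK -[0]vsubmxK -block_mxEh mem_mxjoin !linear0 V20.
  exact: eqxx.
rewrite -[R]vsubmxK Rd0; set R' := usubmx R.
have symR' X : X \in V2 -> (X *m lsubmx R')^T = X *m lsubmx R' /\
    X *m rsubmx R' = 0.
  move=> V2X; have := symR (block_mx X 0 0 0).
  rewrite mem_mxjoin V2X eqxx block_mxEh col_mx0 mul_row0r => /(_ isT).
  rewrite -/R' -[R' in X in X -> _]hsubmxK mul_col_row !mul0mx tr_block_mx.
  by rewrite !trmx0 => /eq_block_mx[-> <- _ _].
rewrite -[R']hsubmxK (@unsymmetrizable_V2 (lsubmx R')) => [|M /symR'[] //].
(* Only the columns of [R'] beyond the third are left. *)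
suff -> : rsubmx R' = 0 by rewrite row_mx0 col_mx0.
(* This member of [V2] has rank 2, so it cancels on the left. *)
have [_ /matrixP R'0] := symR' _ (V2_param 1 0 1).
apply/matrixP; apply: forall_I2 => j.
  by have := R'0 i0 j; rewrite !mxE sum_I2 !mxE /= !simpF2.
by have := R'0 i1 j; rewrite !mxE sum_I2 !mxE /= !simpF2.
Qed.

(** * Degeneracy of the small blocks *)

Lemma degenerate_G3 : degenerate G3.
Proof.
exists (delta_mx 0 i1); first by apply/eqP=> /rowP/(_ i1); rewrite !mxE.
exists (delta_mx i0 0) => [|M /G3P[M10 _ _]].
  by apply/eqP=> /colP/(_ i0); rewrite !mxE.
by rewrite -rowE -colE; apply/matrixP => k l; rewrite !mxE M10.
Qed.

Lemma bilinear_entry n (A : {set 'M['F_2]_(3, n)}) (u : 'rV_3) (x : 'cV_n) :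
    (forall M, M \in A -> u *m M *m x = 0) ->
  forall M, M \in A -> \sum_j (\sum_i u 0 i * M i j) * x j 0 = 0.
Proof.
move=> uAx M AM; transitivity ((u *m M *m x) 0 0); last by rewrite uAx ?mxE.
by rewrite mxE; apply: eq_bigr => j _; rewrite mxE.
Qed.

Lemma rV3_eq0 (v : 'rV['F_2]_3) :
  v 0 i0 = 0 -> v 0 i1 = 0 -> v 0 i2 = 0 -> v = 0.
Proof. by move=> *; apply/rowP; apply: forall_I3; rewrite mxE. Qed.

Lemma cV3_eq0 (v : 'cV['F_2]_3) :
  v i0 0 = 0 -> v i1 0 = 0 -> v i2 0 = 0 -> v = 0.
Proof. by move=> *; apply/colP; apply: forall_I3; rewrite mxE. Qed.

Lemma nondegenerate_H3 (u : 'rV_3) (x : 'cV_3) :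
  (forall M, M \in H3 -> u *m M *m x = 0) -> u = 0 \/ x = 0.
Proof.
move/bilinear_entry => uAx.
have ea := uAx _ (H3_param 1 0 0 0 0 0). expand ea.
have eb := uAx _ (H3_param 0 1 0 0 0 0). expand eb.
have ec := uAx _ (H3_param 0 0 1 0 0 0). expand ec.
have ed := uAx _ (H3_param 0 0 0 1 0 0). expand ed.
have ee := uAx _ (H3_param 0 0 0 0 1 0). expand ee.
have ef := uAx _ (H3_param 0 0 0 0 0 1). expand ef.
move: ea eb ec ed ee ef.
case: (F2P (u 0 i0)) (F2P (u 0 i1)) (F2P (u 0 i2)) => [] u0 [] u1 [] u2;
case: (F2P (x i0 0)) (F2P (x i1 0)) (F2P (x i2 0)) => [] x0 [] x1 [] x2;
by first [left; exact: rV3_eq0 | right; exact: cV3_eq0 |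
  rewrite u0 u1 u2 x0 x1 x2].
Qed.

Lemma nondegenerate_I3 (u : 'rV_3) (x : 'cV_3) :
  (forall M, M \in I3 -> u *m M *m x = 0) -> u = 0 \/ x = 0.
Proof.
move/bilinear_entry => uAx.
have ea := uAx _ (I3_param 1 0 0 0 0 0). expand ea.
have eb := uAx _ (I3_param 0 1 0 0 0 0). expand eb.
have ec := uAx _ (I3_param 0 0 1 0 0 0). expand ec.
have ed := uAx _ (I3_param 0 0 0 1 0 0). expand ed.
have ee := uAx _ (I3_param 0 0 0 0 1 0). expand ee.
have ef := uAx _ (I3_param 0 0 0 0 0 1). expand ef.
move: ea eb ec ed ee ef.
case: (F2P (u 0 i0)) (F2P (u 0 i1)) (F2P (u 0 i2)) => [] u0 [] u1 [] u2;
case: (F2P (x i0 0)) (F2P (x i1 0)) (F2P (x i2 0)) => [] x0 [] x1 [] x2;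
by first [left; exact: rV3_eq0 | right; exact: cV3_eq0 |
  rewrite u0 u1 u2 x0 x1 x2].
Qed.

(** * Traces on the small blocks *)

Lemma addxx (x : 'F_2) : x + x = 0.
Proof. by have [->|->] := F2P x; apply: val_inj. Qed.

Lemma F2_eq (x y : 'F_2) : x + y = 0 -> x = y.
Proof. by move=> xy0; rewrite -[x]addr0 -(addxx y) addrA xy0 add0r. Qed.

Lemma mxtrace_entry (M R : 'M['F_2]_3) :
  \tr (M *m R) = \sum_i \sum_k M i k * R k i.
Proof. by apply: eq_bigr => i _; rewrite mxE. Qed.

Lemma injectively_annihilated_I3 : injectively_annihilated I3.
Proof.
(* [tr (M R)] adds up the entries of the equation defining [M i2 i2], and [R] is
   an involution. *)
pose R : 'M['F_2]_3 :=
  mx_of_rows 3 3 [:: [:: 1; 0; 0]; [:: 0; 1; 0]; [:: 1; 1; 1]].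
exists R.
  rewrite row_full_unit; suff /mulmx1_unit[] : R *m R = 1%:M by [].
  apply/matrixP; apply: forall_I3; apply: forall_I3;
  by rewrite !mxE sum_I3 !mxE; apply: val_inj.
move=> M /I3P[M20 M21 M22]; rewrite mxtrace_entry !sum_I3 !mxE /= !simpF2.
rewrite M22.
have -> (a b c d : 'F_2) : a + c + (b + d + (a + b + c + d)) = 0.
  case: (F2P a) (F2P b) (F2P c) (F2P d) => -> [] -> [] -> [] ->;
  exact: val_inj.
by [].
Qed.

Lemma row_full_inj (R : 'M['F_2]_3) (v : 'cV_3) :
  row_full R -> R *m v = 0 -> v = 0.
Proof.
by case/row_fullP => B BR Rv; rewrite -[v]mul1mx -BR -mulmxA Rv mulmx0.
Qed.

(** The annihilator of [H3] consists of the matrices with rows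
[(0, p, q)], [(p + z, z, 0)] and [(q + z, 0, z)], all singular: if
[z = 1], the kernel contains [(1, p + 1, q + 1)]; if [z = 0], it contains
[(0, q, p)], or everything in case [p = q = 0]. *)
Lemma annihilator_H3_singular (R : 'M['F_2]_3) :
  (forall M, M \in H3 -> \tr (M *m R) = 0) -> ~~ row_full R.
Proof.
move=> trR; apply/negP => Rf.
have ea := trR _ (H3_param 1 0 0 0 0 0); rewrite mxtrace_entry in ea; expand ea.
have eb := trR _ (H3_param 0 1 0 0 0 0); rewrite mxtrace_entry in eb; expand eb.
have ec := trR _ (H3_param 0 0 1 0 0 0); rewrite mxtrace_entry in ec; expand ec.
have ed := trR _ (H3_param 0 0 0 1 0 0); rewrite mxtrace_entry in ed; expand ed.
have ee := trR _ (H3_param 0 0 0 0 1 0); rewrite mxtrace_entry in ee; expand ee.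
have ef := trR _ (H3_param 0 0 0 0 0 1); rewrite mxtrace_entry in ef; expand ef.
move: ea eb ec ed ee ef => R00 /F2_eq R10 /F2_eq R20 /F2_eq R11 R12 R21.
have R_inj a b c :
    R i0 i0 * a + (R i0 i1 * b + R i0 i2 * c) = 0 ->
    R i1 i0 * a + (R i1 i1 * b + R i1 i2 * c) = 0 ->
    R i2 i0 * a + (R i2 i1 * b + R i2 i2 * c) = 0 -> [/\ a = 0, b = 0 & c = 0].
  move=> e0 e1 e2; pose v : 'cV['F_2]_3 := \col_i [:: a; b; c]`_i.
  have /colP v0 : v = 0.
    apply: (row_full_inj Rf).
    by apply/colP; apply: forall_I3; rewrite mxE sum_I3 !mxE.
  by split; [have := v0 i0 | have := v0 i1 | have := v0 i2]; rewrite !mxE.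
move: R_inj; rewrite {}R00 {}R10 {}R20 {}R11 {}R12 {}R21.
have [->|->] := F2P (R i2 i2) => R_inj.
  (* Here [p] and [q] vanish, hence so does [R]. *)
  have [||| _ R02 R01] := R_inj 0 (R i0 i2) (R i0 i1);
    rewrite ?simpF2 ?(mulrC (R i0 i2)) ?addxx //.
  by have [] := R_inj 1 0 0; rewrite ?R01 ?R02 ?simpF2.
have [] := R_inj 1 (R i0 i1 + 1) (R i0 i2 + 1);
  by case: (F2P (R i0 i1)) (F2P (R i0 i2)) => -> [] -> //; apply: val_inj.
Qed.

(** * Separating the types *)

Definition satisfies (I : set_property) (U V : vectType 'F_2)
    (S : {vspace 'Hom(U, V)}) : Prop :=
  exists m n (A : {set 'M['F_2]_(m, n)}), represented_by S A /\ I m n A.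

Lemma satisfies_true (I : set_property) (U V : vectType 'F_2)
    (S : {vspace 'Hom(U, V)}) m n (A : {set 'M['F_2]_(m, n)}) :
  represented_by S A -> I m n A -> satisfies I S <-> true.
Proof. by move=> SA IA; split=> // _; exists m, n, A. Qed.

Lemma satisfies_false (I : set_property) (U V : vectType 'F_2)
    (S : {vspace 'Hom(U, V)}) m n (A : {set 'M['F_2]_(m, n)}) :
    equivalence_invariant I -> represented_by S A -> ~ I m n A ->
  satisfies I S <-> false.
Proof.
move=> invI SA nIA; split=> // [[m' [n' [B [SB IB]]]]]; case: nIA.
exact: represented_by_invariant SB SA IB.
Qed.

(** The types in [dom] having property [I] are those in [yes]. Keeping to [dom]
limits the work to types that no other property has separated. *)
Definition characterizes (I : set_property) (dom yes : seq nat) : Prop :=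
  forall i (U V : vectType 'F_2) (S : {vspace 'Hom(U, V)}),
    has_type i S -> i \in dom -> satisfies I S <-> i \in yes.

Lemma absorbing2_types :
  characterizes (absorbing 2) [:: 1; 2; 3; 4; 5; 6; 7]%N [:: 1; 3]%N.
Proof.
move=> [|[|[|[|[|[|[|[|i]]]]]]]] U V S //=.
- move=> [n [p rep]] _; apply: (satisfies_true rep).
  exact: absorbing_mxjoin (zero_in_mxsym 2).
- move=> [p rep] _; apply: (satisfies_false (@absorbing_invariant 2) rep).
  exact: nonabsorbing_mxcoprod row_at_eq0_S3.
- move=> [n [p rep]] _; apply: (satisfies_true rep).
  exact: absorbing_mxjoin zero_in_V2.
- move=> [p rep] _; apply: (satisfies_false (@absorbing_invariant 2) rep).
  exact: nonabsorbing_mxcoprod row_at_eq0_G3.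
- move=> [p rep] _; apply: (satisfies_false (@absorbing_invariant 2) rep).
  exact: nonabsorbing_mxcoprod row_at_eq0_H3.
- move=> [p rep] _; apply: (satisfies_false (@absorbing_invariant 2) rep).
  exact: nonabsorbing_mxcoprod row_at_eq0_I3.
- move=> [p rep] _; apply: (satisfies_false (@absorbing_invariant 2) rep).
  exact: nonabsorbing_mxcoprod row_at_eq0_H4.
Qed.

Lemma absorbing3_types :
  characterizes (absorbing 3) [:: 2; 4; 5; 6; 7]%N [:: 2; 4; 5; 6]%N.
Proof.
move=> [|[|[|[|[|[|[|[|i]]]]]]]] U V S //=.
- move=> [p rep] _; apply: (satisfies_true rep).
  exact: absorbing_mxcoprod (zero_in_mxsym 3).
- move=> [p rep] _; apply: (satisfies_true rep).
  exact: absorbing_mxcoprod zero_in_G3.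
- move=> [p rep] _; apply: (satisfies_true rep).
  exact: absorbing_mxcoprod zero_in_H3.
- move=> [p rep] _; apply: (satisfies_true rep).
  exact: absorbing_mxcoprod zero_in_I3.
- move=> [p rep] _; apply: (satisfies_false (@absorbing_invariant 3) rep).
  exact: nonabsorbing_mxcoprod row_at_eq0_H4.
Qed.

Lemma symmetrizable_types :
  characterizes symmetrizable [:: 1; 2; 3; 4; 5; 6]%N [:: 1; 2]%N.
Proof.
move=> [|[|[|[|[|[|[|[|i]]]]]]]] U V S //=.
- move=> [n [p rep]] _; apply: (satisfies_true rep).
  exact: symmetrizable_mxsym_join.
- move=> [p rep] _; apply: (satisfies_true rep).
  exact: symmetrizable_mxsym_coprod.
- move=> [n [p rep]] _; apply: (satisfies_false symmetrizable_invariant rep).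
  exact: unsymmetrizable_V2_join.
- move=> [p rep] _; apply: (satisfies_false symmetrizable_invariant rep).
  exact: unsymmetrizable_mxcoprod zero_in_G3 unsymmetrizable_G3.
- move=> [p rep] _; apply: (satisfies_false symmetrizable_invariant rep).
  exact: unsymmetrizable_mxcoprod zero_in_H3 unsymmetrizable_H3.
- move=> [p rep] _; apply: (satisfies_false symmetrizable_invariant rep).
  exact: unsymmetrizable_mxcoprod zero_in_I3 unsymmetrizable_I3.
Qed.

Lemma degenerate_types :
  characterizes degenerate [:: 4; 5; 6]%N [:: 4]%N.
Proof.
move=> [|[|[|[|[|[|[|[|i]]]]]]]] U V S //=.
- move=> [p rep] _; apply: (satisfies_true rep).
  exact: degenerate_mxcoprod degenerate_G3.
- move=> [p rep] _; apply: (satisfies_false degenerate_invariant rep).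
  exact: nondegenerate_mxcoprod zero_in_H3 nondegenerate_H3.
- move=> [p rep] _; apply: (satisfies_false degenerate_invariant rep).
  exact: nondegenerate_mxcoprod zero_in_I3 nondegenerate_I3.
Qed.

Lemma injectively_annihilated_types :
  characterizes injectively_annihilated [:: 5; 6]%N [:: 6]%N.
Proof.
move=> [|[|[|[|[|[|[|[|i]]]]]]]] U V S //=.
- move=> [p rep] _.
  apply: (satisfies_false injectively_annihilated_invariant rep).
  apply: not_injectively_annihilated_mxcoprod zero_in_H3 _.
  exact: annihilator_H3_singular.
- move=> [p rep] _; apply: (satisfies_true rep).
  exact: injectively_annihilated_mxcoprod injectively_annihilated_I3.
Qed.

Lemma characterizes_same (I : set_property) dom yes i j (U V : vectType 'F_2)
    (S : {vspace 'Hom(U, V)}) :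
    characterizes I dom yes -> has_type i S -> has_type j S ->
  i \in dom -> j \in dom -> (i \in yes) = (j \in yes).
Proof.
move=> charI Si Sj di dj.
by apply/idP/idP => [/(charI i _ _ S Si di)/(charI j _ _ S Sj dj)
                    |/(charI j _ _ S Sj dj)/(charI i _ _ S Si di)].
Qed.

Theorem theorem1p8 (i j : nat) (hi : (1 <= i <= 7)%N) (hj : (1 <= j <= 7)%N)
    (hij : i <> j) (U V : vectType 'F_2) (S : {vspace 'Hom(U, V)}) :
  ~ (has_type i S /\ has_type j S).
Proof.
case=> Si Sj.
have e1 := characterizes_same absorbing2_types Si Sj.
have e2 := characterizes_same absorbing3_types Si Sj.
have e3 := characterizes_same symmetrizable_types Si Sj.
have e4 := characterizes_same degenerate_types Si Sj.
have e5 := characterizes_same injectively_annihilated_types Si Sj.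
case: i j hi hj hij e1 e2 e3 e4 e5 {Si Sj} =>
  [|[|[|[|[|[|[|[|i]]]]]]]] [|[|[|[|[|[|[|[|j]]]]]]]] //=
  _ _ hij e1 e2 e3 e4 e5;
  by [case: hij | have := e1 isT isT | have := e2 isT isT | have := e3 isT isT
     | have := e4 isT isT | have := e5 isT isT].
Qed.
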